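(* Let $A_1,A_2\in\mathbb{R}^{n\times n}$ and $B_1,B_2\in\mathbb{R}^{n\times m}$. The systems $\dot x(t)=A_1x(t)+B_1u(t)$ and $\dot y(t)=A_2y(t)+B_2v(t)$ are differentially equivalent if and only if they are linearly equivalent.
   Context: For real matrices $A$ ($n\times n$) and $B$ ($n\times m$), $(A,B)$ denotes the linear controlled system $\dot x(t)=Ax(t)+Bu(t)$, $t\ge 0$, with state $x(t)\in\mathbb{R}^n$ and control $u(t)\in\mathbb{R}^m$. Let $F(x,u)=(H(x),G(x,u))$ with $H:\mathbb{R}^n\to\mathbb{R}^n$ and $G:\mathbb{R}^n\times\mathbb{R}^m\to\mathbb{R}^m$ continuous. One says that $F$ brings $(A_1,B_1)$ to $(A_2,B_2)$ if for every $x^0\in\mathbb{R}^n$ and every $u\in C([0,+\infty);\mathbb{R}^m)$, whenever $x(t)$ is the solution of $(A_1,B_1)$ with $x(0)=x^0$ and control $u$, then $y(t)=H(x(t))$ is the solution of $(A_2,B_2)$ with $y(0)=H(x^0)$ and control $v(t)=G(x(t),u(t))$. Systems $(A_1,B_1)$ and $(A_2,B_2)$ are topologically equivalent if there is such an $F$ which is a homeomorphism of $\mathbb{R}^n\times\mathbb{R}^m$ onto itself, with inverse of the form $F^{-1}(y,v)=(H^{-1}(y),W(y,v))$, such that $F$ brings $(A_1,B_1)$ to $(A_2,B_2)$ and $F^{-1}$ brings $(A_2,B_2)$ to $(A_1,B_1)$. They are differentially equivalent if in addition $F$ can be chosen to be a $C^1$ diffeomorphism of $\mathbb{R}^n\times\mathbb{R}^m$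 onto itself, and linearly equivalent if $F$ can be chosen to be a linear isomorphism of $\mathbb{R}^n\times\mathbb{R}^m$ onto itself. *)

(* Defs.v *)
From HB Require Import structures.
From mathcomp Require Import all_boot all_order all_algebra.
From mathcomp Require Import all_classical all_reals all_analysis.

Set Implicit Arguments.
Unset Strict Implicit.
Unset Printing Implicit Defensive.

Import Order.TTheory GRing.Theory Num.Theory.
Import numFieldNormedType.Exports.

Local Open Scope classical_set_scope.
Local Open Scope ring_scope.

(* Trajectories and controls live on [0, +oo[ but are typed as total functions
   on R; their values at negative times play no role below. *)

(* At time 0 the equation is imposed on the right derivative. *)
Definition is_solution (R : realType) (n m : nat)
    (A : 'M[R]_n) (B : 'M[R]_(n, m)) (x0 : 'cV[R]_n)
    (u : R -> 'cV[R]_m) (x : R -> 'cV[R]_n) : Prop :=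
  [/\ x 0 = x0,
      h^-1 *: (x h - x 0) @[h --> 0^'+] --> A *m x 0 + B *m u 0 &
      forall t : R, 0 < t -> is_derive t 1 x (A *m x t + B *m u t)].

Definition brings (R : realType) (n m : nat)
    (H : 'cV[R]_n -> 'cV[R]_n) (G : 'cV[R]_n * 'cV[R]_m -> 'cV[R]_m)
    (A1 : 'M[R]_n) (B1 : 'M[R]_(n, m))
    (A2 : 'M[R]_n) (B2 : 'M[R]_(n, m)) : Prop :=
  forall (x0 : 'cV[R]_n) (u : R -> 'cV[R]_m),
    {within `[0, +oo[%classic, continuous u} ->
  forall x : R -> 'cV[R]_n, is_solution A1 B1 x0 u x ->
    is_solution A2 B2 (H x0) (fun t => G (x t, u t)) (H \o x).

Definition triangular (R : realType) (n m : nat)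
    (H : 'cV[R]_n -> 'cV[R]_n) (G : 'cV[R]_n * 'cV[R]_m -> 'cV[R]_m) :
    'cV[R]_n * 'cV[R]_m -> 'cV[R]_n * 'cV[R]_m :=
  fun p => (H p.1, G p).

Definition homeomorphism (S T : topologicalType) (f : S -> T) (g : T -> S)
    : Prop :=
  [/\ continuous f, continuous g, cancel f g & cancel g f].

(* Continuity of the differential is with respect to the operator norm. *)
Definition is_C1 (R : realType) (V W : normedModType R) (f : V -> W) : Prop :=
  (forall p : V, differentiable f p) /\
  (forall (p : V) (e : R), 0 < e ->
     \forall q \near p, forall v : V, `|'d f q v - 'd f p v| <= e * `|v|).

(* F = triangular H G realises the equivalence, with inverse triangular K W. *)
Definition equivalence_by (R : realType) (n m : nat)
    (A1 : 'M[R]_n) (B1 : 'M[R]_(n, m)) (A2 : 'M[R]_n) (B2 : 'M[R]_(n, m))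
    (H : 'cV[R]_n -> 'cV[R]_n) (G : 'cV[R]_n * 'cV[R]_m -> 'cV[R]_m)
    (K : 'cV[R]_n -> 'cV[R]_n) (W : 'cV[R]_n * 'cV[R]_m -> 'cV[R]_m) : Prop :=
  [/\ homeomorphism H K,
      homeomorphism (triangular H G) (triangular K W),
      brings H G A1 B1 A2 B2 &
      brings K W A2 B2 A1 B1].

Definition topologically_equivalent (R : realType) (n m : nat)
    (A1 : 'M[R]_n) (B1 : 'M[R]_(n, m)) (A2 : 'M[R]_n) (B2 : 'M[R]_(n, m))
    : Prop :=
  exists H G K W, equivalence_by A1 B1 A2 B2 H G K W.

Definition differentially_equivalent (R : realType) (n m : nat)
    (A1 : 'M[R]_n) (B1 : 'M[R]_(n, m)) (A2 : 'M[R]_n) (B2 : 'M[R]_(n, m))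
    : Prop :=
  exists H G K W,
    [/\ equivalence_by A1 B1 A2 B2 H G K W,
        is_C1 (triangular H G) & is_C1 (triangular K W)].

(* The inverse of a bijective linear map is linear, so only F is constrained. *)
Definition linearly_equivalent (R : realType) (n m : nat)
    (A1 : 'M[R]_n) (B1 : 'M[R]_(n, m)) (A2 : 'M[R]_n) (B2 : 'M[R]_(n, m))
    : Prop :=
  exists H G K W,
    equivalence_by A1 B1 A2 B2 H G K W /\ linear (triangular H G).

(* Main.v *)
From HB Require Import structures.
Require Import Defs.
From mathcomp Require Import all_boot all_order all_algebra.
From mathcomp Require Import all_classical all_reals all_analysis.

Set Implicit Arguments.
Unset Strict Implicit.
Unset Printing Implicit Defensive.

Import Order.TTheory GRing.Theory Num.Theory.
Import numFieldNormedType.Exports.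

Local Open Scope classical_set_scope.
Local Open Scope ring_scope.

(** Why the theorem holds.

    A linear homeomorphism F is its own differential at every point, so it is
    C^1, and so is its inverse; this settles the easy implication.

    For the other one, let F = (H, G) be a C^1 equivalence.  Every pair (x, u)
    is the initial datum of a trajectory with constant control
    ([affine_flow]).  Comparing the velocities at time 0 of this trajectory and
    of its image under H turns the statement about trajectories into an identity
    between functions ([brings_infinitesimal]):

      'd H x (A1 x + B1 u) = A2 (H x) + B2 (G (x, u))   for all x and u.

    Now differentiate this identity at the origin, which is an equilibrium of
    the first system.  The left-hand side involves 'd H, which is only
    continuous, but it is applied to a vector that is linear in (x, u); hence
    along the line h (x, u) the difference quotient at the origin is exactly
    'd H (h x) (A1 x + B1 u), and continuity of 'd H at 0 gives the limit ([infinitesimal_linearized]):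

      'd H 0 (A1 x + B1 u) = A2 ('d H 0 x) + B2 ('d G 0 (x, u)).

    So the linear triangular map 'd F 0 = ('d H 0, 'd G 0) intertwines the two
    systems, which is all that a linear map needs in order to bring one to the
    other ([linear_brings]).  By the chain rule, 'd F 0 is inverted by the
    differential of the inverse of F at F 0.  The point H 0 need not be 0:
    passing to differentials discards the translation. *)

(** * Trajectories with constant control *)

(** Exponential generating function: with the factorials built in, differentiating
    the power series amounts to shifting the sequence [a]. *)
Definition egf (R : realType) (a : R ^nat) : R ^nat := fun k => a k / k`!%:R.

(** Geometric growth of [a] is dominated by the exponential series, whatever the
    ratio, so that the radius of convergence is infinite. *)
Lemma is_cvg_egf (R : realType) (a : R ^nat) (M C : R) :
  0 <= M -> 0 <= C -> (forall k, `|a k| <= M * C ^+ k) ->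
  forall t, cvgn (pseries (egf a) t).
Proof.
move=> M0 C0 aM t; apply: normed_cvg.
apply: (@series_le_cvg _ _ (M *: exp_coeff (C * `|t|))).
- by move=> k; exact: normr_ge0.
- by move=> k; rewrite mulr_ge0// exp_coeff_ge0// mulr_ge0.
- move=> k; rewrite /egf /exp_coeff/= -[X in _ <= X]/(M * _).
  rewrite !normrM normrX normfV normr_nat exprMn.
  rewrite -mulrA [_^-1 * _]mulrC !mulrA ler_wpM2r ?invr_ge0//.
  by rewrite ler_wpM2r// exprn_ge0.
- exact/is_cvg_seriesZ/is_cvg_series_exp_coeff.
Qed.

Lemma pseries_diffs_egf (R : realType) (a : R ^nat) :
  pseries_diffs (egf a) = egf (fun k => a k.+1).
Proof.
apply/funext => k; rewrite /pseries_diffs /egf factS natrM invfM mulrCA.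
by rewrite mulVKf.
Qed.

Lemma is_derive_egf (R : realType) (a : R ^nat) (M C : R) :
  0 <= M -> 0 <= C -> (forall k, `|a k| <= M * C ^+ k) ->
  forall t, is_derive t (1 : R) (fun t => limn (pseries (egf a) t))
    (limn (pseries (egf (fun k => a k.+1)) t)).
Proof.
move=> M0 C0 aM t; rewrite -pseries_diffs_egf.
have shift b N : 0 <= N -> (forall k, `|b k : R| <= N * C ^+ k) ->
    forall k, `|b k.+1| <= N * C * C ^+ k.
  by move=> N0 bN k; rewrite -mulrA -exprS.
have MC0 : 0 <= M * C by rewrite mulr_ge0.
have MCC0 : 0 <= M * C * C by rewrite mulr_ge0.
apply: (@pseries_snd_diffs _ _ (`|t| + 1)); rewrite ?pseries_diffs_egf.
- exact: (is_cvg_egf M0 C0).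
- exact: (is_cvg_egf MC0 C0 (shift _ _ M0 aM)).
- exact: (is_cvg_egf MCC0 C0 (shift _ _ MC0 (shift _ _ M0 aM))).
- by rewrite [ltRHS]ger0_norm ?ltrDl// addr_ge0.
Qed.

(** Dropping the empty partial sum lets the constant term be split off from
    every remaining one. *)
Lemma lim_egfS (R : realType) (a : R ^nat) (t l : R) :
  pseries (egf a) t k.+1 @[k --> \oo] --> l -> limn (pseries (egf a) t) = l.
Proof. by move=> al; apply/cvg_lim => //; rewrite -cvg_shiftS. Qed.

Lemma egf0 (R : realType) (a : R ^nat) : limn (pseries (egf a) 0) = a 0%N.
Proof.
apply: lim_egfS; apply: cvg_near_cst; near=> k.
rewrite /pseries /series/= big_nat_recl//= big1 ?addr0.
  by rewrite /egf fact0 divr1 mulr1.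
by move=> i _; rewrite exprS mul0r mulr0.
Unshelve. all: by end_near. Qed.

(** In finite dimension a linear map is a finite sum of coordinates times
    constant vectors. *)
Lemma linear_cV_continuous (R : realType) (n : nat) (V : normedModType R)
  (f : {linear 'cV[R]_n -> V}) : continuous f.
Proof.
have -> : (f : _ -> _) = fun x => \sum_(i < n) x i 0 *: f (delta_mx i 0).
  apply/funext => x; rewrite {1}[x]matrix_sum_delta linear_sum/=.
  by apply: eq_bigr => i _; rewrite big_ord1 linearZ.
apply: continuous_big => [|i _ x]; first exact: add_continuous.
apply: (@cvgZr_tmp _ _ _ (nbhs x) _ (fun x : 'cV[R]_n => x i 0)).
exact: (@coord_continuous R n 1 i 0).
Qed.

Lemma coord_le_norm (R : realType) (m n : nat) (x : 'M[R]_(m, n)) i j :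
  `|x i j| <= `|x|.
Proof. by rewrite [leRHS]/Num.Def.normr/= mx_normrE; exact: (le_bigmax _ _ (i, j)). Qed.

Lemma is_derive_mx (R : realType) (m n : nat) (x : R -> 'M[R]_(m, n)) t
    (dx : 'M[R]_(m, n)) :
  (forall i j, is_derive t (1 : R) (fun s => x s i j) (dx i j)) ->
  is_derive t (1 : R) x dx.
Proof.
move=> xdx; have dbl : derivable x t 1.
  by apply/derivable_mxP => i j; exact: ex_derive.
split=> //; rewrite derive_mx//; apply/matrixP => i j; rewrite mxE.
exact: derive_val.
Qed.

(** The successive derivatives at time 0 of the solution of x' = A x + b starting
    at [x0]: the constant [b] enters the first derivative only. *)
Fixpoint affine_jet (R : realType) (n : nat) (A : 'M[R]_n) (b x0 : 'cV[R]_n)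
    (k : nat) : 'cV[R]_n :=
  if k is j.+1 then A *m affine_jet A b x0 j + (if j == 0%N then b else 0)
  else x0.

(** The ratio is one more than a Lipschitz constant of [A]: the extra unit
    absorbs the term [b] in the first step. *)
Lemma affine_jet_bound (R : realType) (n : nat) (A : 'M[R]_n) (b x0 : 'cV[R]_n) :
  exists2 C : R, 0 <= C & forall k,
    `|affine_jet A b x0 k| <= (`|x0| + `|b|) * C ^+ k.
Proof.
have [c c0 Ac] := linear_lipschitz (@linear_cV_continuous _ _ _ (mulmx A)).
exists (c + 1); first by rewrite addr_ge0// ltW.
elim=> [|k IHk]; first by rewrite expr0 mulr1 lerDl.
rewrite /= exprS mulrCA mulrDl mul1r.
apply: le_trans (ler_normD _ _) _; apply: lerD.
  by apply: le_trans (Ac _) _; rewrite ler_wpM2l// ltW.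
case: k IHk => [|k] _ /=; first by rewrite expr0 mulr1 lerDr.
by rewrite normr0 mulr_ge0// ?addr_ge0// exprn_ge0// addr_ge0// ltW.
Qed.

(** The solution is the sum of the Taylor series given by [affine_jet], taken
    entry by entry; it solves the equation at negative times as well, so that
    the derivative at 0 is two-sided. *)
Lemma affine_flow (R : realType) (n : nat) (A : 'M[R]_n) (b x0 : 'cV[R]_n) :
  exists2 x : R -> 'cV[R]_n, x 0 = x0 &
    forall t, is_derive t (1 : R) x (A *m x t + b).
Proof.
have [C C0 aC] := affine_jet_bound A b x0.
set a := affine_jet A b x0 in aC; set M := _ + _ in aC.
have M0 : 0 <= M by rewrite addr_ge0.
have aSS k : a k.+2 = A *m a k.+1 by rewrite -[LHS]/(_ + 0) addr0.
have aijC i j k : `|a k i j| <= M * C ^+ k.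
  exact: le_trans (coord_le_norm _ _ _) (aC k).
exists (fun t => \matrix_(i, j) limn (pseries (egf (fun k => a k i j)) t)).
  by apply/matrixP => i j; rewrite mxE egf0.
move=> t; apply: is_derive_mx => i j; under eq_fun do rewrite mxE.
apply: (is_derive_eq (is_derive_egf M0 C0 (aijC i j) t)).
apply: lim_egfS; rewrite !mxE.
under [X in _ --> X + _]eq_bigr do rewrite mxE.
have -> : (fun k => pseries (egf (fun k => a k.+1 i j)) t k.+1) =
  fun k => \sum_l A i l * pseries (egf (fun k => a k l j)) t k.+1 + b i j.
  apply/funext => k; rewrite /pseries /series/=.
  under [in RHS]eq_bigr do rewrite big_distrr/=.
  rewrite exchange_big/= !big_nat_recl//= -addrA [X in _ = _ + X]addrC addrA.
  rewrite /egf; congr (_ + _).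
    rewrite fact0 divr1 !expr0 mulr1 !mxE; congr (_ + _).
    by apply: eq_bigr => l _; rewrite divr1 mulr1.
  apply: eq_bigr => k' _; rewrite aSS !mxE !big_distrl/=.
  by apply: eq_bigr => l _; rewrite !mulrA.
apply: cvgD; last exact: cvg_cst.
apply: (@cvg_big _ _ _ _ _ add_continuous) => l _.
apply: cvgMr; rewrite (cvg_shiftS (pseries _ _)).
exact: (is_cvg_egf M0 C0 (aijC l j)).
Qed.

(** * Differentials of triangular maps *)

Lemma triangular_differentiable (R : realType) (n m : nat)
    (H : 'cV[R]_n -> 'cV[R]_n) (G : 'cV[R]_n * 'cV[R]_m -> 'cV[R]_m) :
  (forall p, differentiable (triangular H G) p) ->
  (forall x, differentiable H x) /\ (forall p, differentiable G p).
Proof.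
move=> dF; split=> [x|p].
  have -> : H = fst \o (triangular H G \o (fun x => (x, 0))) by [].
  apply: differentiable_comp; last first.
    by apply: linear_differentiable => q; exact: cvg_fst.
  apply: differentiable_comp (dF _).
  by apply: differentiable_pair => //; exact: differentiable_cst.
have -> : G = snd \o triangular H G by [].
apply: differentiable_comp (dF _) _.
by apply: linear_differentiable => q; exact: cvg_snd.
Qed.

Lemma diff_triangular (R : realType) (n m : nat)
    (H : 'cV[R]_n -> 'cV[R]_n) (G : 'cV[R]_n * 'cV[R]_m -> 'cV[R]_m) p :
  differentiable H p.1 -> differentiable G p ->
  'd (triangular H G) p =1 triangular ('d H (p.1)) ('d G p).
Proof.
move=> dH dG.
have dfst : differentiable (fst : 'cV[R]_n * 'cV[R]_m -> _) p.
  by apply: linear_differentiable => q; exact: cvg_fst.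
have -> : triangular H G = fun q => ((H \o fst) q, G q) by [].
rewrite diff_pair//; last exact: differentiable_comp.
move=> v; rewrite diff_comp//=.
rewrite (@diff_lin _ _ _ fst)//.
by move=> q; exact: cvg_fst.
Qed.

(** Chain rule applied to [g \o f = id]. *)
Lemma diff_cancel (R : realType) (U V : normedModType R) (f : U -> V)
    (g : V -> U) x :
  differentiable f x -> differentiable g (f x) -> cancel f g ->
  cancel ('d f x) ('d g (f x)).
Proof.
move=> df dg fK v.
have := diff_comp df dg; have -> : g \o f = id by apply/funext => y; exact: fK.
by move=> /(congr1 (fun h => h v))/= <-; rewrite diff_val.
Qed.

Lemma is_derive_diff (R : realType) (V W : normedModType R) (f : V -> W)
    (x : R -> V) t dx :
  differentiable f (x t) -> is_derive t (1 : R) x dx ->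
  is_derive t (1 : R) (f \o x) ('d f (x t) dx).
Proof.
move=> df [dx1 <-]; have dxt : differentiable x t by exact/derivable1_diffP.
have dfx : differentiable (f \o x) t by exact: differentiable_comp.
split; first exact: diff_derivable.
by rewrite !deriveE// diff_comp.
Qed.

Lemma is_derive_right (R : realType) (V : normedModType R) (x : R -> V) dx :
  is_derive 0 (1 : R) x dx -> h^-1 *: (x h - x 0) @[h --> 0^'+] --> dx.
Proof.
move=> [xd <-]; apply: cvg_dnbhs_at_right.
have -> : (fun h => h^-1 *: (x h - x 0)) =
    fun h => h^-1 *: ((x \o shift 0) (h *: 1) - x 0).
  by apply/funext => h; rewrite /= addr0 [h *: 1]mulr1.
exact: xd.
Qed.

(** * From trajectories to a linear identity *)

(** The image of the trajectory through [x] with constant control [u] has two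
    expressions for its right velocity at time 0: the chain rule gives one, the
    second system the other. *)
Lemma brings_infinitesimal (R : realType) (n m : nat)
    (H : 'cV[R]_n -> 'cV[R]_n) (G : 'cV[R]_n * 'cV[R]_m -> 'cV[R]_m)
    (A1 A2 : 'M[R]_n) (B1 B2 : 'M[R]_(n, m)) :
  (forall x, differentiable H x) -> brings H G A1 B1 A2 B2 ->
  forall x u, 'd H x (A1 *m x + B1 *m u) = A2 *m H x + B2 *m G (x, u).
Proof.
move=> dH HG x0 u.
have [x x00 dx] := affine_flow A1 (B1 *m u) x0.
have xsol : is_solution A1 B1 x0 (fun=> u) x.
  by split=> //; exact: is_derive_right.
have [|_ + _] := HG x0 (fun=> u) _ x xsol.
  exact/continuous_subspaceT/cst_continuous.
rewrite /= x00; apply: cvg_unique => //.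
rewrite -x00; apply: (@is_derive_right _ _ (H \o x)).
exact: is_derive_diff.
Qed.

Lemma differentiable_mulmx (R : realType) (V : normedModType R) (p k : nat)
    (A : 'M[R]_(p, k)) (f : V -> 'cV[R]_k) x :
  differentiable f x -> differentiable (mulmx A \o f) x.
Proof.
move=> df; apply: differentiable_comp => //.
by apply: linear_differentiable; exact: linear_cV_continuous.
Qed.

Lemma diff_mulmx (R : realType) (V : normedModType R) (p k : nat)
    (A : 'M[R]_(p, k)) (f : V -> 'cV[R]_k) x v :
  differentiable f x -> 'd (mulmx A \o f) x v = A *m 'd f x v.
Proof.
move=> df; have Ac := @linear_cV_continuous _ _ _ (mulmx A).
have dA y : differentiable (mulmx A : 'cV[R]_k -> _) y.
  exact: linear_differentiable.
have /(congr1 (fun g => g v))/= -> := diff_comp df (dA _).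
by rewrite (diff_lin _ Ac).
Qed.

Lemma fst_le_norm (R : realType) (V W : normedModType R) (p : V * W) :
  `|p.1| <= `|p|.
Proof. by rewrite prod_normE le_max lexx. Qed.

Lemma norm_pair0 (R : realType) (V W : normedModType R) (v : V) :
  `|(v, 0 : W)| = `|v|.
Proof. by rewrite prod_normE/= normr0 max_l. Qed.

(** Both sides of the identity are the derivative at the origin, in the direction
    [(x, u)], of the map [Phi] below.  The right-hand side is the chain rule.  For
    the left-hand side, [Phi] also equals ['d H x (A1 *m x + B1 *m u)], which is
    not known to be differentiable through the chain rule since [H] is only C^1;
    but its difference quotient simplifies because [A1 *m x + B1 *m u] is
    homogeneous. *)
Lemma infinitesimal_linearized (R : realType) (n m : nat)
    (H : 'cV[R]_n -> 'cV[R]_n) (G : 'cV[R]_n * 'cV[R]_m -> 'cV[R]_m)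
    (A1 A2 : 'M[R]_n) (B1 B2 : 'M[R]_(n, m)) :
  is_C1 (triangular H G) ->
  (forall x u, 'd H x (A1 *m x + B1 *m u) = A2 *m H x + B2 *m G (x, u)) ->
  forall x u, 'd H 0 (A1 *m x + B1 *m u) = A2 *m 'd H 0 x + B2 *m 'd G 0 (x, u).
Proof.
move=> [dF cF] HG x u; have [dH dG] := triangular_differentiable dF.
set w := A1 *m x + B1 *m u.
pose Phi (p : 'cV[R]_n * 'cV[R]_m) := A2 *m H p.1 + B2 *m G p.
have dfst : differentiable (fst : 'cV[R]_n * 'cV[R]_m -> _) 0.
  by apply: linear_differentiable => q; exact: cvg_fst.
have dHfst : differentiable (H \o fst) (0 : 'cV[R]_n * 'cV[R]_m).
  exact: differentiable_comp.
have PhiE : Phi = (mulmx A2 \o (H \o fst)) + (mulmx B2 \o G) by [].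
have dA2H : differentiable (mulmx A2 \o (H \o fst)) (0 : 'cV[R]_n * 'cV[R]_m).
  exact: differentiable_mulmx.
have dB2G : differentiable (mulmx B2 \o G) (0 : 'cV[R]_n * 'cV[R]_m).
  exact: differentiable_mulmx.
have dPhi : differentiable Phi 0 by rewrite PhiE; exact: differentiableD.
have dPhiE : 'd Phi 0 (x, u) = A2 *m 'd H 0 x + B2 *m 'd G 0 (x, u).
  have -> : 'd Phi 0 (x, u) = 'd (mulmx A2 \o (H \o fst)) 0 (x, u) +
      'd (mulmx B2 \o G) 0 (x, u).
    by have /(congr1 (fun f => f (x, u))) := diffD dA2H dB2G.
  congr (_ + _); last exact: (diff_mulmx B2 (x, u) (dG 0)).
  apply: (etrans (diff_mulmx A2 (x, u) dHfst)); congr (_ *m _).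
  have /(congr1 (fun f => f (x, u)))/= -> := diff_comp dfst (dH _).
  by rewrite (@diff_lin _ _ _ fst)// => q; exact: cvg_fst.
rewrite -dPhiE -(deriveE (x, u) dPhi).
have PhiHG q : Phi q = 'd H (q.1) (A1 *m q.1 + B1 *m q.2).
  by rewrite HG -surjective_pairing.
have Phi0 : Phi 0 = 0 by rewrite PhiHG !mulmx0 addr0 linear0.
have PhiZ (h : R) : Phi (h *: (x, u)) = h *: 'd H (h *: x) w.
  rewrite PhiHG [(_ *: _).1]/= [(_ *: _).2]/=.
  have -> : A1 *m (h *: x) + B1 *m (h *: u) = h *: w.
    by rewrite /w scalerDr !scalemxAr.
  by rewrite linearZ.
have quotient (h : R) : h != 0 ->
    h^-1 *: ((Phi \o shift 0) (h *: (x, u)) - Phi 0) = 'd H (h *: x) w.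
  move=> h0; rewrite Phi0 subr0 [(_ \o _) _]/= addr0 PhiZ.
  by rewrite scalerA mulVf// scale1r.
apply/esym; rewrite /derive; apply: cvg_lim => //.
apply/cvgrPdist_le => /= e e0.
(* The constant is |w| + 1 rather than |w| to allow w = 0. *)
have e'0 : 0 < e / (`|w| + 1) by rewrite divr_gt0// ltr_wpDl.
(* C^1 regularity is known for F, not for H: the increment of 'd H is bounded by
   that of 'd F on vectors whose second component is zero. *)
have dHE p : 'd H (p.1) w = ('d (triangular H G) p (w, 0)).1.
  have dFp := diff_triangular (dH _) (dG p).
  exact: esym (congr1 fst (dFp (w, 0))).
have dHF p q : `|'d H (q.1) w - 'd H (p.1) w| <=
    `|'d (triangular H G) q (w, 0) - 'd (triangular H G) p (w, 0)|.
  have -> := f_equal2 (fun a b => a - b) (dHE q) (dHE p).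
  exact: (fst_le_norm (_ - _)).
have hxu : h *: (x, 0) @[h --> (0 : R)] --> (0 : 'cV[R]_n * 'cV[R]_m).
  by rewrite -[X in _ --> X](scale0r (x, 0)); exact: scalel_continuous.
have near0 : \forall h \near (0 : R)^', forall v,
    `|'d (triangular H G) (h *: (x, 0)) v - 'd (triangular H G) 0 v| <=
    e / (`|w| + 1) * `|v|.
  exact: (@cvg_within_filter _ _ _ _ _ _ _ hxu _ (cF 0 _ e'0)).
near=> h.
rewrite quotient; last by near: h; exact: nbhs_dnbhs_neq.
rewrite distrC (le_trans (dHF 0 (h *: (x, 0))))//.
rewrite (le_trans (_ : _ <= e / (`|w| + 1) * `|(w, 0 : 'cV[R]_m)|))//.
  by near: h; apply: filterS near0 => h; exact.
rewrite norm_pair0 mulrAC ler_pdivrMr ?ltr_wpDl//.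
by rewrite ler_wpM2l ?lerDl// ltW.
Unshelve. all: by end_near. Qed.

(** * Linear equivalences *)

(** Being linear and continuous, [P] commutes with difference quotients, so the
    velocity of [P \o x] is the image by [P] of the velocity of [x]. *)
Lemma linear_brings (R : realType) (n m : nat)
    (P : {linear 'cV[R]_n -> 'cV[R]_n}) (Q : 'cV[R]_n * 'cV[R]_m -> 'cV[R]_m)
    (A1 A2 : 'M[R]_n) (B1 B2 : 'M[R]_(n, m)) :
  (forall x u, P (A1 *m x + B1 *m u) = A2 *m P x + B2 *m Q (x, u)) ->
  brings P Q A1 B1 A2 B2.
Proof.
move=> PQ x0 u _ x [x00 dx0 dx].
have Pc : continuous P by exact: linear_cV_continuous.
split=> [|/=|t t0]; first by rewrite /= x00.
- rewrite -PQ.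
  have -> : (fun h => h^-1 *: (P (x h) - P (x 0))) =
      P \o (fun h => h^-1 *: (x h - x 0)).
    by apply/funext => h; rewrite [RHS]/= linearZ [P (_ - _)]linearB.
  exact: (cvg_comp _ _ dx0 (Pc _)).
- rewrite /= -PQ -{1}[P (A1 *m _ + _)](congr1 (fun f => f _) (diff_lin (x t) Pc)).
  by apply: is_derive_diff; [exact: linear_differentiable|exact: dx].
Qed.

Lemma linear_is_C1 (R : realType) (V W : normedModType R) (f : V -> W) :
  linear f -> continuous f -> is_C1 f.
Proof.
move=> f_lin fc.
pose f' : {linear V -> W} := HB.pack f (GRing.isLinear.Build _ _ _ _ f f_lin).
split=> [p|p e e0]; first exact: (@linear_differentiable _ _ _ f').
near=> q => v; rewrite !(@diff_lin _ _ _ f')// subrr normr0.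
by rewrite mulr_ge0// ltW.
Unshelve. all: by end_near. Qed.

Lemma linear_cancel (R : realType) (V W : lmodType R) (f : V -> W) (g : W -> V) :
  linear f -> cancel f g -> cancel g f -> linear g.
Proof.
by move=> f_lin fK gK k x y; apply: (can_inj fK); rewrite f_lin !gK.
Qed.

Theorem theorem4p1 (R : realType) (n m : nat)
    (A1 A2 : 'M[R]_n) (B1 B2 : 'M[R]_(n, m)) :
  differentially_equivalent A1 B1 A2 B2 <-> linearly_equivalent A1 B1 A2 B2.
Proof.
split=> [[H [G [K [W [[[_ _ HK KH] [_ _ FK KF] HG KW] CF CK]]]]]|]; last first.
  move=> [H [G [K [W [eqv F_lin]]]]]; exists H, G, K, W; split => //.
  - by case: eqv => _ [Fc _ _ _] _ _; exact: linear_is_C1.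
  - case: eqv => _ [_ Kc FK KF] _ _; apply: linear_is_C1 => //.
    exact: linear_cancel F_lin FK KF.
have [dH dG] := triangular_differentiable CF.1.
have [dK dW] := triangular_differentiable CK.1.
set F0 := triangular H G 0.
(* The inverse has to be differentiated at F0, the image of the origin. *)
have K0 : K (H 0) = 0 by rewrite HK.
have F0K : triangular K W F0 = 0 by rewrite FK.
have dFE := @diff_triangular R n m H G 0 (dH _) (dG _).
have dKE := @diff_triangular R n m K W F0 (dK _) (dW _).
have PQ := infinitesimal_linearized CF (brings_infinitesimal dH HG).
have dHK : cancel ('d H 0) ('d K (H 0)) by exact: diff_cancel.
have dKH : cancel ('d K (H 0)) ('d H 0).
  by rewrite -[X in 'd H X]K0; exact: diff_cancel.
have dFK : cancel (triangular ('d H 0) ('d G 0)) (triangular ('d K (H 0)) ('d W F0)).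
  by apply: eq_can dFE dKE; apply: diff_cancel FK; [exact: CF.1|exact: CK.1].
have dKF : cancel (triangular ('d K (H 0)) ('d W F0)) (triangular ('d H 0) ('d G 0)).
  apply: eq_can dKE dFE; rewrite -[X in 'd (triangular H G) X]F0K.
  by apply: diff_cancel KF; [exact: CK.1|exact: CF.1].
exists ('d H 0), ('d G 0), ('d K (H 0)), ('d W F0); split; last first.
  by rewrite -(funext dFE); exact: linearP.
split.
- split; [ | |exact: dHK|exact: dKH].
  + by apply: diff_continuous; exact: dH.
  + by apply: diff_continuous; exact: dK.
- split; [ | |exact: dFK|exact: dKF].
  + by rewrite -(funext dFE); apply: diff_continuous; exact: CF.1.
  + by rewrite -(funext dKE); apply: diff_continuous; exact: CK.1.
- exact: linear_brings.
- apply: linear_brings => y v.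
  (* Apply the injective map 'd H 0 and use the identity for (H, G) at the
     preimage of (y, v) by the linearised equivalence. *)
  have e := dKF (y, v).
  apply: (can_inj dHK); apply: etrans (dKH _) _; apply: etrans _ (esym (PQ _ _)).
  exact: esym (f_equal2 (fun a b => A2 *m a + B2 *m b)
    (congr1 fst e) (congr1 snd e)).
Qed.
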